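(* Let $G=(V,D,B)$ be a mixed graph and let $(Y_v : v\in V)$ be a family of subsets of $V$. Suppose that for each node $v\in V$ the set $Y_v$ satisfies the half-trek criterion with respect to $v$, and that there is a total ordering $\prec$ on $V$ such that $w\prec v$ whenever $w\in Y_v\cap \mathrm{htr}(v)$. Then $G$ is rationally identifiable.
   Context: A mixed graph is a triple $G=(V,D,B)$ with $V=[m]=\{1,\dots,m\}$, $D\subseteq V\times V$ a set of directed edges, written $v\to w$, and $B\subseteq V\times V$ a symmetric set of bidirected edges, written $v\leftrightarrow w$ ($v\leftrightarrow w\in B$ iff $w\leftrightarrow v\in B$); there are no self-loops $v\to v$ or $v\leftrightarrow v$. $G$ is acyclic if $(V,D)$ contains no directed cycle. Write $\mathrm{pa}(v)=\{w: w\to v\in D\}$ and $\mathrm{sib}(v)=\{w : w\leftrightarrow v\in B\}$. Let $\mathbb{R}^D$ be the set of real $m\times m$ matrices $\Lambda=(\lambda_{vw})$ with $\lambda_{vw}=0$ whenever $v\to w\notin D$, and $\mathbb{R}^D_{\mathrm{reg}}$ the subset with $I-\Lambda$ invertible. Let $\mathrm{PD}(B)$ be the set of positive definite symmetric $m\times m$ matrices $\Omega=(\omega_{vw})$ with $\omega_{vw}=0$ whenever $v\neq w$ and $v\leftrightarrow w\notin B$. Put $\Theta=\mathbb{R}^D_{\mathrm{reg}}\times\mathrm{PD}(B)$ and $\phi_G(\Lambda,\Omega)=(I-\Lambda)^{-T}\Omega(I-\Lambda)^{-1}$. An algebraic subset of $\Theta$ is the set of points of $\Theta$ where a family of polynomials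 in the entries of $(\Lambda,\Omega)$ vanishes; it is proper if it is not all of $\Theta$. $G$ is rationally identifiable if there exist a proper algebraic subset $W\subset\Theta$ and a rational map $\psi$ with $\psi(\phi_G(\Lambda,\Omega))=(\Lambda,\Omega)$ for all $(\Lambda,\Omega)\in\Theta\setminus W$. Treks: a path is a sequence of edges of $D\cup B$ connecting consecutive nodes; it need not be simple and directed edges may be traversed in either direction. A trek from $v$ to $w$ is a path of the form $v=v^L_l\leftarrow\cdots\leftarrow v^L_1\leftarrow v^L_0\leftrightarrow v^R_0\to v^R_1\to\cdots\to v^R_r=w$ (with $\mathrm{Left}(\pi)=\{v^L_0,\dots,v^L_l\}$, $\mathrm{Right}(\pi)=\{v^R_0,\dots,v^R_r\}$), or of the form $v=v^L_l\leftarrow\cdots\leftarrow v^L_1\leftarrow v^T\to v^R_1\to\cdots\to v^R_r=w$ with $l,r\ge 0$ (with $\mathrm{Left}(\pi)=\{v^T,v^L_1,\dots,v^L_l\}$, $\mathrm{Right}(\pi)=\{v^T,v^R_1,\dots,v^R_r\}$; when $l=r=0$ this is the trivial trek at $v^T$). $v$ is the source and $w$ the target. A half-trek is a trek with $|\mathrm{Left}(\pi)|=1$, i.e. a path of the form $v\leftrightarrow w_0\to w_1\to\cdots\to w_r$ or $v\to w_1\to\cdots\to w_r$ (or trivial). A set of $n$ treks $\Pi=\{\pi_1,\dots,\pi_n\}$ whose sources $x_1,\dots,x_n$ are distinct and whose targets $y_1,\dots,y_n$ are distinct is a system of treks from $X=\{x_i\}$ to $Y=\{y_i\}$; it is a system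 of half-treks if each $\pi_i$ is a half-trek. $\Pi$ has no sided intersection if $\mathrm{Left}(\pi_i)\cap\mathrm{Left}(\pi_j)=\emptyset=\mathrm{Right}(\pi_i)\cap\mathrm{Right}(\pi_j)$ for all $i\ne j$. $\mathrm{htr}(v)$ is the set of nodes $w\in V\setminus(\{v\}\cup\mathrm{sib}(v))$ such that there is a half-trek from $v$ to $w$. A set $Y\subseteq V$ satisfies the half-trek criterion with respect to $v$ if (i) $|Y|=|\mathrm{pa}(v)|$, (ii) $Y\cap(\{v\}\cup\mathrm{sib}(v))=\emptyset$, and (iii) there is a system of half-treks with no sided intersection from $Y$ to $\mathrm{pa}(v)$. *)

(* Defs.v *)
From HB Require Import structures.
From mathcomp Require Import all_boot all_order all_algebra.
Set Implicit Arguments. Unset Strict Implicit. Unset Printing Implicit Defensive.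
Import Order.TTheory GRing.Theory Num.Theory.

(* Mixed graphs on V = 'I_m : directed edges D (D v w  <->  v -> w)    *)
(* and bidirected edges B (B v w <-> v <-> w).  The standing axioms    *)
(* (no self-loops, B symmetric) are hypotheses of the theorem.         *)
Section Graph.
Variable m : nat.
Notation V := 'I_m.
Variables (D B : rel V).

Definition pa (v : V) : {set V} := [set w | D w v].
Definition sib (v : V) : {set V} := [set w | B w v].

(* A trek.  [tl0; tls...] = v^L_0, v^L_1, ..., v^L_l (left part, read
   from the top down to the source) and [tr0; trs...] = v^R_0, ..., v^R_r
   (right part, from the top down to the target).  If [tbi] is true the
   top is a bidirected edge v^L_0 <-> v^R_0, otherwise the top is the node
   v^T = v^L_0 = v^R_0. *)
Record trek := Trek { tbi : bool; tl0 : V; tls : seq V; tr0 : V; trs : seq V }.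

Definition is_trek (t : trek) : bool :=
  [&& path D (tl0 t) (tls t), path D (tr0 t) (trs t) &
      (if tbi t then B (tl0 t) (tr0 t) else tl0 t == tr0 t)].

Definition source (t : trek) : V := last (tl0 t) (tls t).
Definition target (t : trek) : V := last (tr0 t) (trs t).
Definition Left (t : trek) : seq V := tl0 t :: tls t.
Definition Right (t : trek) : seq V := tr0 t :: trs t.

Definition is_halftrek (t : trek) : bool :=
  is_trek t && (size (undup (Left t)) == 1%N).

Definition system_of_halftreks (s : seq trek) (X Y : {set V}) : bool :=
  [&& all is_halftrek s,
      uniq (map source s), [set x in map source s] == X,
      uniq (map target s) & [set y in map target s] == Y].

Definition no_sided_intersection (s : seq trek) : bool :=
  pairwise (fun p q =>
     all (fun x => x \notin Left q) (Left p) &&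
     all (fun x => x \notin Right q) (Right p)) s.

Definition in_htr (v w : V) : Prop :=
  w \notin v |: sib v /\
  exists t, is_halftrek t /\ source t = v /\ target t = w.

Definition HTC (v : V) (Y : {set V}) : Prop :=
  [/\ #|Y| = #|pa v|,
      Y :&: (v |: sib v) = set0 &
      exists s, system_of_halftreks s Y (pa v) && no_sided_intersection s].

End Graph.

Inductive polyexpr (R : Type) (X : Type) : Type :=
| PVar of X
| PConst of R
| PAdd of polyexpr R X & polyexpr R X
| PMul of polyexpr R X & polyexpr R X.

Fixpoint peval (R : pzRingType) (X : Type) (e : X -> R) (p : polyexpr R X) : R :=
  match p with
  | PVar x => e x
  | PConst c => c
  | PAdd p q => peval e p + peval e q
  | PMul p q => peval e p * peval e q
  end.

Section Param.
Variable R : realFieldType.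
Local Open Scope ring_scope.
Variable m : nat.
Notation V := 'I_m.
Variables (D B : rel V).

Definition in_RDreg (L : 'M[R]_m) : Prop :=
  (forall v w, ~~ D v w -> L v w = 0) /\ (1%:M - L) \in unitmx.

Definition in_PD (O : 'M[R]_m) : Prop :=
  [/\ O^T = O,
      (forall v w, v != w -> ~~ B v w -> O v w = 0) &
      (forall x : 'cV[R]_m, x != 0 -> 0 < (x^T *m O *m x) 0 0)].

Definition in_Theta (L O : 'M[R]_m) : Prop := in_RDreg L /\ in_PD O.

Definition phiG (L O : 'M[R]_m) : 'M[R]_m :=
  (invmx (1%:M - L))^T *m O *m invmx (1%:M - L).

Definition coord := ((V * V) + (V * V))%type.
Definition theta_coord (L O : 'M[R]_m) (k : coord) : R :=
  match k with inl (v, w) => L v w | inr (v, w) => O v w end.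

Definition in_alg_subset (F : polyexpr R coord -> Prop) (L O : 'M[R]_m) : Prop :=
  in_Theta L O /\ forall p, F p -> peval (theta_coord L O) p = 0.

Definition proper_alg_subset (F : polyexpr R coord -> Prop) : Prop :=
  exists L O, in_Theta L O /\ ~ in_alg_subset F L O.

(* A rational map psi from matrices Sigma to coordinates of (Lambda, Omega):
   each coordinate is a quotient num/den of polynomials in the entries of
   Sigma.  psi(Sigma) = (Lambda, Omega) means every denominator is nonzero
   at Sigma (psi is defined there) and every quotient gives the
   corresponding coordinate. *)
Definition ratmap := coord -> (polyexpr R (V * V) * polyexpr R (V * V)).

Definition ratmap_maps_to (psi : ratmap) (S : 'M[R]_m) (L O : 'M[R]_m) : Prop :=
  forall k, let ev := peval (fun p : V * V => S p.1 p.2) in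
    ev (psi k).2 != 0 /\ ev (psi k).1 / ev (psi k).2 = theta_coord L O k.

Definition rationally_identifiable : Prop :=
  exists (F : polyexpr R coord -> Prop) (psi : ratmap),
    proper_alg_subset F /\
    forall L O, in_Theta L O -> ~ in_alg_subset F L O ->
      ratmap_maps_to psi (phiG L O) L O.

End Param.

(* Main.v *)
Require Import Defs.
From HB Require Import structures.
From mathcomp Require Import all_boot all_order all_algebra.
From mathcomp Require Import ring lra.
Set Implicit Arguments. Unset Strict Implicit. Unset Printing Implicit Defensive.
Import Order.TTheory GRing.Theory Num.Theory.

(* With M = 1 - L and Sigma = phiG L O, the identities M^T Sigma M = O and
   Sigma M = (M^-1)^T O show that the column of L at v, restricted to pa(v),
   solves a square linear system with one equation per y in Y_v: the row of
   M^T Sigma at y if y is half-trek reachable from v, the row of Sigma at y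
   otherwise.  Going through the nodes along the ordering, Cramer's rule then
   makes L, hence O, a rational function of Sigma wherever all the determinants
   of these systems are nonzero.

   Each determinant is shown to be nonzero at one explicit point, where O need
   not be positive definite: L is the indicator of the edges on the right paths
   of a half-trek system, and O that of the pairs {source, top of the right
   path}.  If the system has as few bidirected tops as possible, the map sending
   i to the path through the i-th source has no nontrivial cycle (one could
   reroute along it), and this makes the system of equations triangular with
   positive diagonal.  Polynomials that are nonzero somewhere on a linear space
   have a common nonzero point there, and moving from (0, 1) towards that point
   by a small amount reaches Theta. *)

(** * Half-trek systems *)

Section HalfTrekSystems.
Variables (m : nat) (D B : rel 'I_m) (n : nat).
Implicit Types (y : 'I_n -> 'I_m) (s : 'I_n -> seq 'I_m) (P : {set 'I_m}).

Definition top y s i := head (y i) (s i).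
Definition bottom y s i := last (y i) (s i).

(** Only sources and right paths are stored: the left part of a half-trek is its source alone, so
    injectivity of [y] already keeps the left sides disjoint. *)
Definition halftrek_system y s P : Prop :=
  [/\ injective y,
      forall i, [/\ s i != [::], sorted D (s i), uniq (s i) &
                    (y i == top y s i) || B (y i) (top y s i)],
      forall i j a, a \in s i -> a \in s j -> i = j &
      P = [set bottom y s i | i : 'I_n]].

(** The tail of [s (f i)] starting at [y i] needs no bidirected edge at its top. *)
Definition rewired y s (f : 'I_n -> 'I_n) i :=
  if y i \in s (f i) then drop (index (y i) (s (f i))) (s (f i)) else s i.

(** Each new path is a tail of [s (f i)]: disjointness is inherited through injectivity of [f], and
    the bottoms are merely permuted. *)
Lemma halftrek_system_rewired y s P f : injective f ->
  (forall i, f i = i \/ y i \in s (f i)) ->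
  halftrek_system y s P -> halftrek_system y (rewired y s f) P.
Proof.
move=> injf fP [injy sP sdisj PE].
have lastE i : bottom y (rewired y s f) i = bottom y s (f i).
  rewrite /bottom /rewired; case: ifP => [yi|nyi]; last by case: (fP i) => [->//|]; rewrite nyi.
  rewrite -{3}(cat_take_drop (index (y i) (s (f i))) (s (f i))) last_cat.
  move: (yi); rewrite -index_mem => lt; rewrite (drop_nth (y i) lt) /=.
  case: (s (f i)) lt => [//|b t] _ //=.
have sub i : {subset rewired y s f i <= s (f i)}.
  rewrite /rewired; case: ifP => [yi|nyi] a; first exact: mem_drop.
  by case: (fP i) => [->//|]; rewrite nyi.
split=> // [i|i j a /sub ai /sub aj|].
- rewrite /top /rewired; case: ifP => [yi|_]; last exact: sP.
  have [_ sr un _] := sP (f i); split.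
  + by rewrite -size_eq0 size_drop -lt0n subn_gt0 index_mem.
  + exact: drop_sorted.
  + exact: drop_uniq.
  + by rewrite (drop_nth (y i)) ?index_mem //= nth_index // eqxx.
- by apply: injf; apply: sdisj ai aj.
- rewrite PE; apply/setP=> a; apply/imsetP/imsetP => -[i _ ->].
    exists (invF injf i) => //; by rewrite lastE f_invF.
  by exists (f i).
Qed.

Definition bidirected_count y s := #|[pred i | y i != top y s i]|.

(* No permutation can improve the system by letting sources start directly
   from a node of another right path. *)
Definition irreducible_system y s : Prop :=
  forall f, injective f -> (forall i, f i = i \/ y i \in s (f i)) ->
  forall i, y i \in s (f i) -> y i = top y s i.

Lemma exists_irreducible_system y s P : halftrek_system y s P ->
  exists s', halftrek_system y s' P /\ irreducible_system y s'.
Proof.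
have [k] := ubnP (bidirected_count y s); elim: k s => // k IHk s ltk sysS.
have [/existsP[f /and3P[/injectiveP injf /forallP fP /existsP[i /andP[yi neq]]]]|none] :=
  boolP [exists f : {ffun 'I_n -> 'I_n}, [&& injectiveb f,
    [forall i, (f i == i) || (y i \in s (f i))] &
    [exists i, (y i \in s (f i)) && (y i != top y s i)]]].
  apply: (IHk (rewired y s f)); last first.
    by apply: halftrek_system_rewired => // j; case/orP: (fP j) => [/eqP|]; [left|right].
  (* Rewiring creates no bidirected top and removes the one at [i], so the count drops. *)
  apply: leq_trans (proper_card _) (ltk : _ <= k)%N.
  apply/properP; split.
    apply/subsetP => j; rewrite !inE /top /rewired; case: ifP => // yj.
    by rewrite (drop_nth (y j)) ?index_mem //= nth_index // eqxx.
  exists i; rewrite inE // /top /rewired yi.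
  by rewrite (drop_nth (y i)) ?index_mem //= nth_index // eqxx.
exists s; split=> // f injf fP i yi; apply/eqP; apply: contraNT none => neq.
apply/existsP; exists [ffun i => f i]; apply/and3P; split.
- by apply/injectiveP => a b; rewrite !ffunE; apply: injf.
- by apply/forallP => j; rewrite ffunE; case: (fP j) => [->|->]; rewrite ?eqxx ?orbT.
- by apply/existsP; exists i; rewrite ffunE yi.
Qed.

(** Disjointness leaves at most one path through [y i]; the default makes a source on no path a
    fixed point. *)
Definition next_path y s (i : 'I_n) : 'I_n := odflt i [pick k | y i \in s k].

Lemma next_pathP y s P i k : halftrek_system y s P -> y i \in s k ->
  next_path y s i = k.
Proof.
case=> _ _ sdisj _ yi; rewrite /next_path; case: pickP => [l yl|/(_ k)].
  exact: sdisj yl yi.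
by rewrite yi.
Qed.

(* The orbit of a periodic point of next_path gives a permutation to which
   irreducibility applies. *)
Lemma next_path_acyclic y s P i k : halftrek_system y s P ->
  irreducible_system y s -> y i \in s k -> y i != top y s i ->
  ~~ fconnect (next_path y s) k i.
Proof.
move=> sysS irrS yi neq; apply/negP => con; set g := next_path y s in con.
have gi : g i = k := next_pathP sysS yi.
pose O j := fconnect g i j.
have Oi : O i by exact: connect0.
have gO j : O j -> O (g j) by move=> Oj; apply: connect_trans Oj (fconnect1 _ _).
(* Some positive iterate of [g] fixes [i], hence the whole orbit of [i], so [g] is injective
   there. *)
have ginj j l : O j -> O l -> g j = g l -> j = l.
  have cyc : iter (findex g k i).+1 g i = i.
    by rewrite iterSr gi iter_findex.
  set N := (findex g k i).+1 in cyc.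
  have cycO j0 : O j0 -> iter N g j0 = j0.
    by move=> /iter_findex <-; rewrite -iterD addnC iterD cyc.
  by move=> Oj Ol e; rewrite -(cycO j) // -(cycO l) // /N !iterSr e.
pose f j := if O j then g j else j.
have injf : injective f.
  move=> j l; rewrite /f; case Oj: (O j); case Ol: (O l) => //.
  - exact: ginj.
  - by move=> e; move: (gO j Oj); rewrite e Ol.
  - by move=> e; move: (gO l Ol); rewrite -e Oj.
have fP j : f j = j \/ y j \in s (f j).
  rewrite /f; case: ifP => Oj; last by left.
  by rewrite /g /next_path; case: pickP => [l yl|_] /=; [right|left].
have yfi : y i \in s (f i) by rewrite /f Oi gi.
by move/eqP: neq; apply; apply: (irrS f).
Qed.

End HalfTrekSystems.

(** * From the half-trek criterion to path systems *)

Lemma map_tnthP (T : Type) (U : eqType) (f : T -> U) (r : seq T) a :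
  reflect (exists i, a = f (tnth (in_tuple r) i)) (a \in map f r).
Proof.
apply: (iffP (tnthP (map_tuple f (in_tuple r)) a)) => -[i ->].
  by exists i; rewrite tnth_map.
by exists i; rewrite tnth_map.
Qed.

Lemma HTC_system (m : nat) (D B : rel 'I_m) (v : 'I_m) (Y : {set 'I_m}) :
  HTC D B v Y -> exists n (y : 'I_n -> 'I_m) s,
    (forall i, y i \in Y) /\ halftrek_system D B y s (pa D v).
Proof.
case=> _ _ [ts /andP[/and5P[allh uns /eqP <- unt /eqP <-] nsi]].
pose t := tnth (in_tuple ts).
have ht i : is_halftrek D B (t i).
  by move: i; exact: (elimT (@all_tnthP _ _ (is_halftrek D B) (in_tuple ts)) allh).
(* The left part has one distinct node, so its two ends, the top and the source, coincide. *)
have src i : source (t i) = tl0 (t i).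
  have /andP[_ /eqP sz] := ht i.
  have : source (t i) \in undup (Left (t i)) by rewrite mem_undup mem_last.
  have : tl0 (t i) \in undup (Left (t i)) by rewrite mem_undup mem_head.
  case: (undup _) sz => [//|a [|//]] _; by rewrite !inE => /eqP -> /eqP ->.
(* Right paths may revisit nodes; [shortenP] extracts a simple path with the same ends from each. *)
have /fin_all_exists[s sP] i : exists s, [/\ s != [::], sorted D s, uniq s,
    {subset s <= Right (t i)} & head (source (t i)) s = tr0 (t i) /\
    last (source (t i)) s = target (t i)].
  have /andP[/and3P[_ pr _] _] := ht i; rewrite /target /Right.
  case: (shortenP pr) => p' pp un sub; exists (tr0 (t i) :: p'); split=> //= a.
  by rewrite !inE => /predU1P[->|/sub ->]; rewrite ?eqxx ?orbT.
exists (size ts), (fun i => source (t i)), s; split.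
  by move=> i; rewrite inE; apply/map_tnthP; exists i.
split.
- move=> i j; rewrite !src => e; apply: val_inj => /=.
  pose x0 := t i.
  apply/eqP; rewrite -(nth_uniq (source x0) _ _ uns) ?size_map ?ltn_ord //.
  rewrite !(nth_map x0) ?ltn_ord // -!(tnth_nth _ (in_tuple ts)).
  by rewrite -/(t i) -/(t j) !src e.
- move=> i; have [s0 ss us sub [hd _]] := sP i; split=> //.
  rewrite /top hd src; have /andP[/and3P[_ _]] := ht i.
  by case: ifP => _ ->; rewrite ?orbT.
- move=> i j a; have [_ _ _ subi _] := sP i; have [_ _ _ subj _] := sP j.
  move=> /subi ai /subj aj.
  wlog lt_ij : i j ai aj subi subj / (i < j)%N.
    move=> hw; case: (ltngtP i j) => [|lt|/val_inj //]; first exact: hw.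
    by apply/esym; apply: hw lt.
  pose x0 := t i; have /(pairwiseP x0)/(_ i j) := nsi.
  rewrite !inE !ltn_ord => /(_ isT isT lt_ij) /andP[_ /allP/(_ a)].
  by rewrite -!(tnth_nth _ (in_tuple ts)) -/(t i) -/(t j) => /(_ ai); rewrite aj.
- apply/setP=> a; rewrite inE; apply/map_tnthP/imsetP => -[i]; last first.
    by move=> _ ->; exists i; rewrite /bottom; have [_ _ _ _ [_ ->]] := sP i.
  by move=> ->; exists i => //; rewrite /bottom; have [_ _ _ _ [_ ->]] := sP i.
Qed.

Local Open Scope ring_scope.

(** * Polynomial and rational functions *)

Section FunctionClasses.
Variables (R : fieldType) (T : Type).

(** Serves to prove closure under determinants, adjugates and matrix products once for polynomial
    and rational functions alike. *)
Definition function_subalgebra (C : (T -> R) -> Prop) : Prop :=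
  [/\ forall f g, f =1 g -> C f -> C g,
      forall c, C (fun=> c),
      forall f g, C f -> C g -> C (fun t => f t + g t) &
      forall f g, C f -> C g -> C (fun t => f t * g t)].

Section Closure.
Variables (C : (T -> R) -> Prop) (algC : function_subalgebra C).

Lemma fsub_ext f g : f =1 g -> C f -> C g.
Proof. by case: algC => h _ _ _; apply: h. Qed.

Lemma fsub_const c : C (fun=> c).
Proof. by case: algC. Qed.

Lemma fsub_add f g : C f -> C g -> C (fun t => f t + g t).
Proof. by case: algC => _ _ h _; apply: h. Qed.

Lemma fsub_mul f g : C f -> C g -> C (fun t => f t * g t).
Proof. by case: algC => _ _ _ h; apply: h. Qed.

Lemma fsub_sub f g : C f -> C g -> C (fun t => f t - g t).
Proof.
move=> Cf Cg; apply: fsub_add => //.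
by apply: fsub_ext (fsub_mul (fsub_const (-1)) Cg) => t; rewrite mulN1r.
Qed.

Lemma fsub_sum (I : Type) (r : seq I) (P : pred I) (F : I -> T -> R) :
  (forall i, C (F i)) -> C (fun t => \sum_(i <- r | P i) F i t).
Proof.
move=> CF; elim: r => [|i r IHr].
  by apply: fsub_ext (fsub_const 0) => t; rewrite big_nil.
case Pi: (P i); last by apply: fsub_ext IHr => t; rewrite big_cons Pi.
by apply: fsub_ext (fsub_add (CF i) IHr) => t; rewrite big_cons Pi.
Qed.

Lemma fsub_prod (I : Type) (r : seq I) (P : pred I) (F : I -> T -> R) :
  (forall i, C (F i)) -> C (fun t => \prod_(i <- r | P i) F i t).
Proof.
move=> CF; elim: r => [|i r IHr].
  by apply: fsub_ext (fsub_const 1) => t; rewrite big_nil.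
case Pi: (P i); last by apply: fsub_ext IHr => t; rewrite big_cons Pi.
by apply: fsub_ext (fsub_mul (CF i) IHr) => t; rewrite big_cons Pi.
Qed.

Lemma fsub_det n (A : T -> 'M[R]_n) :
  (forall i j, C (fun t => A t i j)) -> C (fun t => \det (A t)).
Proof.
move=> CA; apply: fsub_sum => s; apply: fsub_mul; first exact: fsub_const.
by apply: fsub_prod => i; apply: CA.
Qed.

Lemma fsub_adj n (A : T -> 'M[R]_n) i j :
  (forall i j, C (fun t => A t i j)) -> C (fun t => (\adj (A t)) i j).
Proof.
move=> CA; apply: (@fsub_ext (fun t => cofactor (A t) j i)).
  by move=> t; rewrite mxE.
apply: fsub_mul; first exact: fsub_const.
apply: fsub_det => k l.
by apply: fsub_ext (CA (lift j k) (lift i l)) => t; rewrite !mxE.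
Qed.

Lemma fsub_mulmx m n p (A : T -> 'M[R]_(m, n)) (B : T -> 'M[R]_(n, p)) i j :
  (forall k, C (fun t => A t i k)) -> (forall k, C (fun t => B t k j)) ->
  C (fun t => (A t *m B t) i j).
Proof.
move=> CA CB; apply: (@fsub_ext (fun t => \sum_k A t i k * B t k j)).
  by move=> t; rewrite mxE.
by apply: fsub_sum => k; apply: fsub_mul.
Qed.

End Closure.

Variables (X : Type) (e : T -> X -> R).

Definition polyfun (f : T -> R) : Prop :=
  exists q : polyexpr R X, forall t, f t = peval (e t) q.

Lemma polyfun_subalgebra : function_subalgebra polyfun.
Proof.
split=> [f g fg [q qE]|c|f g [p pE] [q qE]|f g [p pE] [q qE]].
- by exists q => t; rewrite -fg.
- by exists (PConst X c).
- by exists (PAdd p q) => t /=; rewrite pE qE.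
- by exists (PMul p q) => t /=; rewrite pE qE.
Qed.

Lemma polyfun_var x : polyfun (fun t => e t x).
Proof. by exists (PVar R x). Qed.

Variable P : T -> Prop.

(** Values outside [P] are unconstrained, so a function can be inverted as soon as it has no zero on
    [P]. *)
Definition ratfun (f : T -> R) : Prop :=
  exists a b : polyexpr R X, forall t, P t ->
    peval (e t) b != 0 /\ f t = peval (e t) a / peval (e t) b.

Lemma ratfun_ext f g : (forall t, P t -> f t = g t) -> ratfun f -> ratfun g.
Proof.
by move=> fg [a [b ab]]; exists a, b => t Pt; rewrite -fg //; apply: ab.
Qed.

Lemma polyfun_rat f : polyfun f -> ratfun f.
Proof.
by case=> q qE; exists q, (PConst X 1) => t _ /=; rewrite oner_neq0 divr1.
Qed.

Lemma ratfun_subalgebra : function_subalgebra ratfun.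
Proof.
split=> [f g fg|c|f g [a [b ab]] [c [d cd]]|f g [a [b ab]] [c [d cd]]].
- by apply: ratfun_ext => t _.
- by apply: polyfun_rat; exists (PConst X c).
- exists (PAdd (PMul a d) (PMul c b)), (PMul b d) => t Pt /=.
  have [[b0 ->] [d0 ->]] := (ab t Pt, cd t Pt).
  by rewrite mulf_neq0 // addf_div.
- exists (PMul a c), (PMul b d) => t Pt /=.
  have [[b0 ->] [d0 ->]] := (ab t Pt, cd t Pt).
  by rewrite mulf_neq0 // mulf_div.
Qed.

Lemma ratfun_inv f : (forall t, P t -> f t != 0) -> ratfun f ->
  ratfun (fun t => (f t)^-1).
Proof.
move=> f0 [a [b ab]]; exists b, a => t Pt.
have [b0 fE] := ab t Pt; rewrite fE invf_div; split=> //.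
by apply: contraNneq (f0 t Pt) => a0; rewrite fE a0 mul0r.
Qed.

End FunctionClasses.

Section Polynomials.
Variable R : realFieldType.

(** The [size q] numbers d/(k+2) are distinct and lie strictly between 0 and d, and a nonzero [q]
    has fewer roots than that. *)
Lemma poly_nonroot_lt (q : {poly R}) (d : R) : q != 0 -> 0 < d ->
  exists t, [/\ 0 < t, t < d & q.[t] != 0].
Proof.
move=> q0 d0; pose rs := [seq d / k.+2%:R | k <- iota 0 (size q)].
have : ~~ all (root q) rs.
  apply/negP => /(max_poly_roots q0)/(_ _) lt_q.
  suff /lt_q : uniq rs by rewrite size_map size_iota ltnn.
  rewrite map_inj_uniq ?iota_uniq // => k l /(mulfI (lt0r_neq0 d0))/invr_inj.
  by move/eqP; rewrite eqr_nat => /eqP[].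
case/allPn => _ /mapP[k _ ->] nr; exists (d / k.+2%:R); split=> //.
  by rewrite divr_gt0 // ltr0n.
by rewrite ltr_pdivrMr ?ltr0n // ltr_pMr // ltr1n.
Qed.

End Polynomials.

(** * A point with nonzero determinant *)

(** A kernel vector vanishes by strong induction on the rank: the off-diagonal terms of equation [i]
    involve only coordinates of smaller rank. *)
Lemma det_neq0_of_rank (F : fieldType) (n : nat) (A : 'M[F]_n) (rk : 'I_n -> nat) :
  (forall i, A i i != 0) ->
  (forall i j, i != j -> A i j != 0 -> (rk j < rk i)%N) -> \det A != 0.
Proof.
move=> diagA triA; rewrite -det_tr; apply/det0P => -[u u0 uA].
case/eqP: u0; apply/rowP=> i; rewrite mxE.
have [k] := ubnP (rk i); elim: k i => // k IHk i lt_i.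
have := congr1 (fun v : 'rV_n => v 0 i) uA; rewrite !mxE (bigD1 i) //= big1.
  by rewrite addr0 mxE => /eqP; rewrite mulf_eq0 (negbTE (diagA i)) orbF => /eqP.
move=> j ne; rewrite mxE; have [->|Aij] := eqVneq (A i j) 0; first by rewrite mulr0.
rewrite IHk ?mul0r //; apply: leq_trans (triA i j _ Aij) lt_i.
by rewrite eq_sym.
Qed.

Section WitnessPoint.
Variables (R : realFieldType) (m : nat) (D B : rel 'I_m) (n : nat).
Variables (y : 'I_n -> 'I_m) (s : 'I_n -> seq 'I_m) (P : {set 'I_m}).
Hypothesis sysS : halftrek_system D B y s P.

Definition before a b :=
  [exists k, [&& a \in s k, b \in s k & (index a (s k) < index b (s k))%N]].

Definition adjacent a b :=
  [exists k, [&& a \in s k, b \in s k & index b (s k) == (index a (s k)).+1]].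

Definition joined a b :=
  [exists k, (a == y k) && (b == top y s k) || (a == top y s k) && (b == y k)].

Definition path_weights : 'M[R]_m := \matrix_(a, b) (adjacent a b)%:R.
Definition path_sums : 'M[R]_m := \matrix_(a, b) ((a == b) || before a b)%:R.
Definition top_weights : 'M[R]_m := \matrix_(a, b) (joined a b)%:R.

Let sdisj i j a : a \in s i -> a \in s j -> i = j.
Proof. by case: sysS => _ _ h _; apply: h. Qed.

Lemma beforeE k a b : a \in s k ->
  before a b = (b \in s k) && (index a (s k) < index b (s k))%N.
Proof.
move=> ak; apply/existsP/andP => [[l /and3P[al bl lt]]|[bk lt]].
  by rewrite (sdisj ak al).
by exists k; rewrite ak bk.
Qed.

Lemma adjacentE k a b : a \in s k ->
  adjacent a b = (b \in s k) && (index b (s k) == (index a (s k)).+1).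
Proof.
move=> ak; apply/existsP/andP => [[l /and3P[al bl lt]]|[bk lt]].
  by rewrite (sdisj ak al).
by exists k; rewrite ak bk.
Qed.

(** The product telescopes: row [a] of [path_sums] minus the row of the successor of [a] is the unit
    row at [a]. A node without successor has a unit row from the start. *)
Lemma path_weightsM_sums : (1%:M - path_weights) *m path_sums = 1%:M.
Proof.
apply/matrixP=> a b; rewrite mulmxBl mul1mx !mxE.
have [/existsP[c0 adj0]|noadj] := boolP [exists c, adjacent a c]; last first.
  rewrite big1 => [|c _]; last first.
    by move: noadj; rewrite negb_exists => /forallP/(_ c)/negbTE adjF; rewrite !mxE adjF mul0r.
  rewrite subr0; congr (_%:R); case: eqP => //= _.
  case: (boolP (before a b)) => // /existsP[k /and3P[ak bk lt]].
  case/negP: noadj; apply/existsP; exists (nth a (s k) (index a (s k)).+1).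
  have lt' : ((index a (s k)).+1 < size (s k))%N.
    by apply: leq_ltn_trans lt _; rewrite index_mem.
  have [_ /(_ k)[_ _ un _] _ _] := sysS.
  by rewrite (adjacentE _ ak) mem_nth // index_uniq // eqxx.
have /existsP[k /and3P[ak ck /eqP ic]] := adj0.
rewrite (bigD1 c0) //= big1 ?addr0 => [|c ne]; last first.
  rewrite !mxE (adjacentE _ ak); case: (boolP (c \in s k)) => cs; rewrite ?mul0r //=.
  case: eqP => [e|]; rewrite ?mul0r //; case/eqP: ne.
  by apply: (index_inj a cs ck); rewrite /= e ic.
rewrite !mxE adj0 mul1r (beforeE _ ak) (beforeE _ ck) ic.
have [bk|bk] := boolP (b \in s k); last first.
  by rewrite !orbF; case: (c0 =P b) bk => [<-|_ _]; rewrite ?ck // subr0.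
have inE' c : c \in s k -> (c == b) = (index c (s k) == index b (s k)).
  by move=> cs; apply/eqP/eqP => [->//|]; apply: (index_inj a).
rewrite !inE' //= ic; set p := index a _; set q := index b _.
by rewrite /= -!leq_eqVlt; case: (ltngtP p q) => _; rewrite ?subrr ?subr0.
Qed.

Lemma path_weights_support a b : ~~ D a b -> path_weights a b = 0.
Proof.
move=> nD; rewrite mxE; case: (boolP (adjacent a b)) => // /existsP[k].
case/and3P => ak bk /eqP ib; case/negP: nD.
have [_ /(_ k)[_ so _ _] _ _] := sysS.
have lt : ((index a (s k)).+1 < size (s k))%N by rewrite -ib index_mem.
move: so ak bk ib lt; case: (s k) => // c t /= pt ak bk ib lt.
have := (pathP c pt) (index a (c :: t)) lt.
rewrite (nth_index c ak) -[nth c t _]/(nth c (c :: t) (index a (c :: t)).+1).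
by rewrite -ib nth_index.
Qed.

Lemma top_weights_sym : top_weights^T = top_weights.
Proof.
apply/matrixP=> a b; rewrite !mxE; congr (nat_of_bool _)%:R.
by apply: eq_existsb => k; rewrite orbC andbC [_ && (a == _)]andbC.
Qed.

Lemma top_weights_support a b : symmetric B -> a != b -> ~~ B a b ->
  top_weights a b = 0.
Proof.
move=> symB ne nB; rewrite mxE; case: (boolP (joined a b)) => // /existsP[k].
have [_ /(_ k)[_ _ _ yt] _ _] := sysS.
case/orP => /andP[/eqP ea /eqP eb]; move: yt; rewrite -ea -eb.
  by rewrite (negbTE ne) (negbTE nB).
by rewrite symB (negbTE nB) eq_sym (negbTE ne).
Qed.

Hypothesis irrS : irreducible_system y s.

(** Lexicographic order: first the size of the orbit of [i] under [next_path], then the position of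
    [y i] on its path. The factor [m.+1] exceeds every such position. *)
Definition trek_rank i :=
  let g := next_path y s in
  (#|fconnect g i| * m.+1 + index (y i) (s (g i)))%N.

Lemma top_mem i : top y s i \in s i.
Proof.
have [_ /(_ i)[+ _ _ _] _ _] := sysS; rewrite /top.
by case: (s i) => // c t _; rewrite mem_head.
Qed.

Lemma bottom_mem i : bottom y s i \in s i.
Proof.
have [_ /(_ i)[+ _ _ _] _ _] := sysS; rewrite /bottom.
by case: (s i) => // c t _; rewrite /= mem_last.
Qed.

Lemma index_lt_card k a : (index a (s k) < m.+1)%N.
Proof.
have [_ /(_ k)[_ _ un _] _ _] := sysS.
rewrite ltnS; apply: leq_trans (index_size _ _) _.
by rewrite -(card_uniqP un) -[X in (_ <= X)%N]card_ord max_card.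
Qed.

Lemma fconnect_next i a : fconnect (next_path y s) (next_path y s i) a ->
  fconnect (next_path y s) i a.
Proof. exact: connect_trans (fconnect1 _ _). Qed.

(** The orbit of [i] contains that of [k] and also [i] itself, which acyclicity keeps out of the
    orbit of [k]. *)
Lemma connect_card_ltn i k : y i \in s k -> y i != top y s i ->
  (#|fconnect (next_path y s) k| < #|fconnect (next_path y s) i|)%N.
Proof.
move=> yi neq; have gi := next_pathP sysS yi; apply/proper_card/properP; split.
  by apply/subsetP => a; rewrite !inE -{1}gi; apply: fconnect_next.
exists i; rewrite ?inE ?connect0 //; exact: next_path_acyclic sysS irrS yi neq.
Qed.

Lemma trek_rank_connect i j :
  (#|fconnect (next_path y s) j| < #|fconnect (next_path y s) i|)%N ->
  (trek_rank j < trek_rank i)%N.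
Proof.
move=> lt; rewrite /trek_rank.
apply: leq_trans (leq_addr _ _); apply: leq_trans (leq_mul lt (leqnn _)).
by rewrite mulSn addnC ltn_add2r index_lt_card.
Qed.

(** Both sources lie on one path [k]. The orbit of [j] has at most one element more than that of
    [k], and the orbit of [i] at least one more, since [y i] is not a top. A tie is broken by the
    positions on [k]. *)
Lemma trek_rank_before i j : before (y j) (y i) -> (trek_rank j < trek_rank i)%N.
Proof.
case/existsP => k /and3P[yj yi lt].
have [gi gj] := (next_pathP sysS yi, next_pathP sysS yj).
have neq : y i != top y s i.
  apply: contraTneq lt => yt; rewrite -leqNgt.
  have ik : i = k by apply: sdisj yi; rewrite yt top_mem.
  rewrite -ik yt; have := top_mem i; rewrite /top.
  by case: (s i) => //= c t _; rewrite eqxx.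
have lt_card := connect_card_ltn yi neq.
suff le_card : (#|fconnect (next_path y s) j| <= #|fconnect (next_path y s) i|)%N.
  by rewrite /trek_rank gi gj -addnS leq_add // leq_mul2r le_card orbT.
apply: leq_trans lt_card; set g := next_path y s in gj *.
rewrite (eq_card (B := [predU1 j & fconnect g k])) => [|a]; last first.
  by rewrite !inE fconnect_eqVf gj eq_sym.
by rewrite cardU1 -[X in (_ <= X)%N]add1n leq_add2r leq_b1.
Qed.


Lemma path_weights_unit : 1%:M - path_weights \in unitmx.
Proof. by have [] := mulmx1_unit path_weightsM_sums. Qed.

Lemma path_sumsE : invmx (1%:M - path_weights) = path_sums.
Proof.
by rewrite -[RHS](mulKmx path_weights_unit) path_weightsM_sums mulmx1.
Qed.

(** Row [y i] of the factor to the left of O: the identity in O M^-1, and (M^-1)^T in Sigma. *)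
Definition start_weights (h : 'I_n -> bool) i a : R :=
  if h i then (a == y i)%:R else path_sums a (y i).

Lemma start_weights_ge0 h i a : 0 <= start_weights h i a.
Proof. by rewrite /start_weights; case: ifP; rewrite ?mxE ler0n. Qed.

Lemma start_weights_self h i : start_weights h i (y i) = 1.
Proof. by rewrite /start_weights mxE eqxx; case: ifP. Qed.

Lemma start_weights_neq0 h i a : start_weights h i a != 0 ->
  (a == y i) || before a (y i).
Proof.
rewrite /start_weights mxE; case: ifP => _; case: (a == y i) => //=; first by rewrite eqxx.
by case: before; rewrite // eqxx.
Qed.

Lemma path_sums_bottom a j : path_sums a (bottom y s j) != 0 -> a \in s j.
Proof.
rewrite mxE; have bj := bottom_mem j.
have [->//|_ /=] := eqVneq a; have [/existsP[k /and3P[ak bk _]] _|_] := boolP (before _ _).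
  by rewrite (sdisj bj bk).
by rewrite eqxx.
Qed.

Lemma path_sums_top_bottom i : path_sums (top y s i) (bottom y s i) = 1.
Proof.
rewrite mxE; have [//|ne] := eqVneq (top y s i); rewrite /= (beforeE _ (top_mem i)).
rewrite bottom_mem /=; suff -> : index (top y s i) (s i) = 0%N.
  rewrite lt0n; case: eqP => // e; case/eqP: ne.
  have := nth_index (y i) (bottom_mem i); rewrite e => <-.
  by rewrite /top nth0.
have := top_mem i; rewrite /top.
by case: (s i) => //= c t _; rewrite eqxx.
Qed.

Definition witness_matrix h : 'M[R]_n := \matrix_(i, j)
  \sum_a \sum_c start_weights h i a * top_weights a c * path_sums c (bottom y s j).

Lemma witness_term_ge0 h i j a c :
  0 <= start_weights h i a * top_weights a c * path_sums c (bottom y s j).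
Proof. by rewrite !mulr_ge0 ?start_weights_ge0 // mxE ler0n. Qed.

(** A nonzero term gives a pair (a, c) joined by some [k], with [a] equal to or before [y i] and [c]
    on [s j]. If [a] is the source of [k], then k = j and [y j] comes before [y i]. *)
Lemma witness_matrix_rank h i j : i != j -> witness_matrix h i j != 0 ->
  (trek_rank j < trek_rank i)%N.
Proof.
move=> ne; rewrite mxE => nz.
have /existsP[a /existsP[c]] : [exists a, exists c,
    start_weights h i a * top_weights a c * path_sums c (bottom y s j) != 0].
  apply: contraNT nz; rewrite negb_exists => /forallP allF.
  rewrite big1 // => a _; rewrite big1 // => c _; apply/eqP; apply/negPn.
  by have := allF a; rewrite negb_exists => /forallP.
rewrite !mulf_eq0 !negb_or -andbA => /and3P[/start_weights_neq0 ya ac /path_sums_bottom cj].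
have {ac} /existsP[k] : joined a c.
  by move: ac; rewrite mxE; case: joined; rewrite ?eqxx.
have direct : a = y k -> c = top y s k -> (trek_rank j < trek_rank i)%N.
  move=> ea ec; have jk : k = j by apply: sdisj cj; rewrite ec top_mem.
  move: ya; rewrite ea jk => /orP[/eqP|]; last exact: trek_rank_before.
  by case: sysS => injy _ _ _ /injy ji; rewrite ji eqxx in ne.
case/orP => /andP[/eqP ea /eqP ec]; first exact: direct.
have [e|neq] := eqVneq (y k) (top y s k).
  by apply: direct; [rewrite ea e|rewrite ec e].
(* With the pair read backwards, [y i] lies on [s k] and [y k] on [s j], so [next_path] leads from
   [i] to [k] to [j] and the orbits shrink. *)
have yik : y i \in s k.
  have tk := top_mem k; case/orP: ya => [/eqP <-|]; first by rewrite ea.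
  by rewrite ea (beforeE _ tk) => /andP[].
rewrite ec in cj.
apply: trek_rank_connect; apply: leq_trans (connect_card_ltn cj neq) _.
apply/subset_leq_card/subsetP => b; rewrite !inE -(next_pathP sysS yik).
exact: fconnect_next.
Qed.

(** All terms are nonnegative, and the one for the half-trek [i] itself equals 1. *)
Lemma witness_matrix_diag h i : witness_matrix h i i != 0.
Proof.
rewrite gt_eqF // mxE (bigD1 (y i)) //= (bigD1 (top y s i)) //= -addrA ltr_wpDr //.
  by rewrite addr_ge0 ?sumr_ge0 // => a _; rewrite ?sumr_ge0 // => *; rewrite witness_term_ge0.
rewrite start_weights_self path_sums_top_bottom mxE mul1r mulr1 ltr0n lt0b.
by apply/existsP; exists i; rewrite !eqxx.
Qed.

End WitnessPoint.

(** * The linear systems for the columns of L *)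

Section IdentifyingMatrix.
Variables (R : realFieldType) (m : nat) (D B : rel 'I_m).
Notation params := ('M[R]_m * 'M[R]_m)%type.
Implicit Types (L O : 'M[R]_m) (v w : 'I_m).

Definition param_space L O : Prop :=
  [/\ forall v w, ~~ D v w -> L v w = 0, O^T = O &
      forall v w, v != w -> ~~ B v w -> O v w = 0].

Definition half_matrix n (h : 'I_n -> bool) (y p : 'I_n -> 'I_m) L O : 'M[R]_n :=
  \matrix_(i, j) (if h i then O *m invmx (1%:M - L) else phiG L O) (y i) (p j).

(** [half_matrix] with denominators cleared: each row is scaled by det(1 - L) or its square, which
    makes the entries polynomial in (L, O). *)
Definition adj_half_matrix n (h : 'I_n -> bool) (y p : 'I_n -> 'I_m) L O : 'M[R]_n :=
  \matrix_(i, j) (if h i then O *m \adj (1%:M - L)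
    else (\adj (1%:M - L))^T *m O *m \adj (1%:M - L)) (y i) (p j).

Lemma det_adj_half_matrix n h (y p : 'I_n -> 'I_m) L O : 1%:M - L \in unitmx ->
  (\det (adj_half_matrix h y p L O) == 0) = (\det (half_matrix h y p L O) == 0).
Proof.
move=> uM; set d := \det (1%:M - L).
have d0 : d != 0 by rewrite -unitfE -unitmxE.
have adjE : \adj (1%:M - L) = d *: invmx (1%:M - L).
  by rewrite /invmx uM scalerA divff // scale1r.
have -> : adj_half_matrix h y p L O =
    diag_mx (\row_i (if h i then d else d ^+ 2)) *m half_matrix h y p L O.
  apply/matrixP=> i j; rewrite mul_diag_mx !mxE adjE; case: ifP => _.
    by rewrite -scalemxAr mxE.
  by rewrite [(_ *: _)^T]linearZ /= -scalemxAr -!scalemxAl scalerA mxE expr2.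
rewrite det_mulmx mulf_eq0 det_diag; case: eqP => //= /eqP.
rewrite prodf_seq_eq0 => /hasP[i _]; rewrite mxE /=.
by case: ifP => _; rewrite ?expf_eq0 (negbTE d0).
Qed.

Lemma half_matrix_witness n (y : 'I_n -> 'I_m) s P h :
  halftrek_system D B y s P ->
  half_matrix h y (bottom y s) (path_weights R s) (top_weights R y s) =
  witness_matrix R y s h.
Proof.
move=> sysS; apply/matrixP=> i j; rewrite !mxE /phiG (path_sumsE R sysS).
rewrite /start_weights; case: ifP => _.
  rewrite mxE [RHS](bigD1 (y i)) //= [X in _ = _ + X]big1 ?addr0 => [|a ne].
    by apply: eq_bigr => c _; rewrite eqxx mul1r.
  by apply: big1 => c _; rewrite (negbTE ne) !mul0r.
rewrite mxE exchange_big /=; apply: eq_bigr => c _.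
by rewrite mxE mulr_suml; apply: eq_bigr => a _; rewrite [_^T _ _]mxE.
Qed.

(** [y] and [p] precede [h]: one half-trek system serves every choice of which rows come from O M^-1
    and which from Sigma. *)
Lemma HTC_half_matrix v Y : symmetric B -> HTC D B v Y ->
  exists n (y p : 'I_n -> 'I_m),
  [/\ injective p, pa D v = [set p i | i : 'I_n], forall i, y i \in Y &
      forall h, exists L O, [/\ param_space L O, 1%:M - L \in unitmx &
                                \det (half_matrix h y p L O) != 0]].
Proof.
move=> symB /HTC_system[n [y [s0 [yY /exists_irreducible_system[s [sysS irrS]]]]]].
have sdisj : forall i j a, a \in s i -> a \in s j -> i = j by case: sysS.
exists n, y, (bottom y s); split=> //.
- move=> i j e; apply: sdisj (bottom_mem sysS i) _.
  by rewrite e (bottom_mem sysS).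
- by case: sysS.
move=> h; exists (path_weights R s), (top_weights R y s); split.
- split; [exact: path_weights_support sysS|exact: top_weights_sym|].
  by move=> a b; apply: top_weights_support sysS a b symB.
- exact: path_weights_unit sysS.
rewrite (half_matrix_witness h sysS).
apply: (det_neq0_of_rank (rk := trek_rank y s)).
  exact: witness_matrix_diag sysS h.
exact: witness_matrix_rank sysS irrS h.
Qed.

(* The vectors supported on the nodes reachable from w form an invariant
   subspace of 1 - L, hence of its inverse. *)
Lemma invmx_connect L v w : (forall a b, ~~ D a b -> L a b = 0) ->
  1%:M - L \in unitmx -> ~~ connect D w v -> invmx (1%:M - L) w v = 0.
Proof.
move=> suppL uM nwv; set M := 1%:M - L in uM *.
pose E : 'M[R]_m := diag_mx (\row_a (connect D w a)%:R).
(* [E] projects onto the nodes reachable from [w]; the equation says that no edge leaves this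
   set. *)
have EM : E *m M *m E = E *m M.
  apply/matrixP=> a b; rewrite mul_mx_diag mul_diag_mx !mxE.
  case: (boolP (connect D w a)) => wa; last by rewrite !mul0r.
  case: (boolP (connect D w b)) => wb; first by rewrite mulr1.
  rewrite mulr0 mul1r suppL; last first.
    by apply: contra wb => /connect1; apply: connect_trans.
  by case: (a =P b) wb => [<-|_ _]; rewrite ?wa // subr0.
(* [M] is invertible, so [E *m M] has the rank of [E] and its row space, contained in that of [E],
   is all of it. *)
have : (E <= E *m M)%MS.
  have /mxrank_leqif_eq/leqifP : (E *m M <= E)%MS by rewrite -EM submxMl.
  rewrite mxrankMfree ?row_free_unit // ltnn.
  by case: ifP => // /eqmxP h _; rewrite -h.
case/submxP=> C EC.
have : (E *m invmx M) w v = (C *m E) w v by rewrite {1}EC -mulmxA mulmxK.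
by rewrite mul_mx_diag mul_diag_mx !mxE connect0 mul1r (negbTE nwv) mulr0.
Qed.

End IdentifyingMatrix.

(** * Common nonzeros and positive definiteness *)

Section Lines.
Variables (R : realFieldType) (m : nat) (D B : rel 'I_m).
Notation params := ('M[R]_m * 'M[R]_m)%type.
Implicit Types (S Q : params).

Definition theta_env (S : params) := theta_coord S.1 S.2.

Definition line S Q (t : R) : params :=
  (S.1 + t *: (Q.1 - S.1), S.2 + t *: (Q.2 - S.2)).

Lemma line0 S Q : line S Q 0 = S.
Proof. by rewrite /line !scale0r !addr0; case: S. Qed.

Lemma line1 S Q : line S Q 1 = Q.
Proof. by rewrite /line !scale1r !subrKC; case: Q. Qed.

Lemma polyfun_line f S Q : polyfun theta_env f ->
  exists q : {poly R}, forall t, f (line S Q t) = q.[t].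
Proof.
case=> e fE.
suff [q qE] : exists q : {poly R}, forall t, peval (theta_env (line S Q t)) e = q.[t].
  by exists q => t; rewrite fE.
elim: e {fE} => [x|c|e1 [q1 E1] e2 [q2 E2]|e1 [q1 E1] e2 [q2 E2]].
- exists ((theta_env S x)%:P + (theta_env Q x - theta_env S x)%:P * 'X) => t.
  by rewrite !hornerE; case: x => -[a b] /=; rewrite !mxE mulrC.
- by exists c%:P => t; rewrite hornerC.
- by exists (q1 + q2) => t; rewrite hornerD -E1 -E2.
- by exists (q1 * q2) => t; rewrite hornerM -E1 -E2.
Qed.

Lemma line_nonzero f g S Q d : polyfun theta_env f -> polyfun theta_env g ->
  f S != 0 -> g Q != 0 -> 0 < d ->
  exists t, [/\ 0 < t, t < d, f (line S Q t) != 0 & g (line S Q t) != 0].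
Proof.
move=> /(polyfun_line S Q)[p pE] /(polyfun_line S Q)[q qE] fS gQ d0.
have p0 : p != 0.
  by apply: contraNneq fS => p0; rewrite -(line0 S Q) pE p0 horner0.
have q0 : q != 0.
  by apply: contraNneq gQ => q0; rewrite -(line1 S Q) qE q0 horner0.
have [t [t0 td]] := poly_nonroot_lt (mulf_neq0 p0 q0) d0.
rewrite hornerM mulf_eq0 negb_or => /andP[pt qt].
by exists t; rewrite pE qE.
Qed.

Lemma param_space_line S Q t : param_space D B S.1 S.2 ->
  param_space D B Q.1 Q.2 -> param_space D B (line S Q t).1 (line S Q t).2.
Proof.
move=> [SD Ssym SB] [QD Qsym QB]; split=> [a b nD||a b ne nB] /=.
- by rewrite !mxE SD // QD // subr0 mulr0 addr0.
- by rewrite linearD linearZ linearB /= Ssym Qsym.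
- by rewrite !mxE SB // QB // subr0 mulr0 addr0.
Qed.

Definition base_point : params := (0, 1%:M).

Lemma param_space_base : param_space D B base_point.1 base_point.2.
Proof.
split=> [a b _||a b ne _]; first by rewrite mxE.
  by rewrite trmx1.
by rewrite mxE (negbTE ne).
Qed.

(** Induction on [r]: on the line from a point good for the tail to one good for the new factor,
    some point is good for both. *)
Lemma common_nonzero (I : eqType) (r : seq I) (f : I -> params -> R) :
  (forall i, polyfun theta_env (f i)) ->
  (forall i, exists S, param_space D B S.1 S.2 /\ f i S != 0) ->
  exists S, param_space D B S.1 S.2 /\ \prod_(i <- r) f i S != 0.
Proof.
move=> pf ex; elim: r => [|i r [S [spS nzS]]].
  exists base_point; split; first exact: param_space_base.
  by rewrite big_nil oner_neq0.
have [Q [spQ nzQ]] := ex i.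
have pr : polyfun theta_env (fun S => \prod_(i <- r) f i S).
  by apply: fsub_prod => //; apply: polyfun_subalgebra.
have [t [_ _ nz1 nz2]] := line_nonzero pr (pf i) nzS nzQ ltr01.
exists (line S Q t); split; first exact: param_space_line.
by rewrite big_cons mulf_neq0.
Qed.

(** Each product of two coordinates of [x] is at most the sum of squares in absolute value, so the
    sum of the absolute entries of [A] is a valid constant. *)
Lemma quadratic_form_bound (A : 'M[R]_m) : exists K, 0 <= K /\
  forall x : 'cV[R]_m, - (K * \sum_i x i 0 ^+ 2) <= (x^T *m A *m x) 0 0.
Proof.
exists (\sum_i \sum_j `|A i j|); split.
  by apply: sumr_ge0 => i _; apply: sumr_ge0.
move=> x; set s := \sum_i _ ^+ 2.
have xs i : x i 0 ^+ 2 <= s.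
  by rewrite /s (bigD1 i) //= lerDl sumr_ge0 // => j _; rewrite sqr_ge0.
rewrite mxE exchange_big /= mulr_suml -sumrN ler_sum // => j _.
rewrite mxE !mulr_suml -sumrN ler_sum // => i _; rewrite mxE lerNl.
have -> : - (x i 0 * A i j * x j 0) = A i j * - (x i 0 * x j 0) by ring.
apply: le_trans (ler_norm _) _; rewrite normrM ler_wpM2l // ler_norml.
have := xs i; have := xs j; have := sqr_ge0 (x i 0 - x j 0).
have := sqr_ge0 (x i 0 + x j 0); rewrite !expr2 => *; apply/andP; split; nra.
Qed.

Lemma line_PD S : param_space D B S.1 S.2 ->
  exists d, 0 < d /\ forall t, 0 < t -> t < d -> in_PD B (line base_point S t).2.
Proof.
move=> spS; have [K [K0 Kb]] := quadratic_form_bound (S.2 - 1%:M).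
(* With s the squared norm of [x], the form at time [t] is at least (1 - tK)s; adding 1 to K keeps
   the bound on [t] meaningful when K = 0. *)
exists (1 + K)^-1; split; first by rewrite invr_gt0 ltr_pwDl.
move=> t t0 td; have [_ sym sup] := param_space_line t param_space_base spS.
split=> // x x0 /=.
rewrite mulmxDr mulmxDl mulmx1 -scalemxAr -scalemxAl mxE [in X in _ + X]mxE.
set q := (x^T *m _ *m x) 0 0; have := Kb x; rewrite -/q.
have -> : (x^T *m x) 0 0 = \sum_i x i 0 ^+ 2.
  by rewrite mxE; apply: eq_bigr => i _; rewrite mxE expr2.
set s := \sum_i _ => qb.
have s0 : 0 < s.
  have [i xi] : exists i, x i 0 != 0.
    apply/existsP; apply: contraNT x0; rewrite negb_exists => /forallP all0.
    apply/eqP/colP=> i; rewrite mxE; apply/eqP; apply/negPn; exact: all0.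
  rewrite /s (bigD1 i) //= ltr_pwDl ?exprn_even_gt0 //.
  by rewrite sumr_ge0 // => j _; rewrite sqr_ge0.
have tK : t * (1 + K) < 1 by rewrite -ltr_pdivlMr ?ltr_pwDl // mul1r.
have : t * - (K * s) <= t * q by rewrite ler_wpM2l // ltW.
have : 0 < s * (1 - t * K) by rewrite mulr_gt0 // subr_gt0; lra.
move=> *; lra.
Qed.

End Lines.

(** * Solving for one column of L *)

Section Columns.
Variables (R : realFieldType) (m : nat) (D B : rel 'I_m).
Notation params := ('M[R]_m * 'M[R]_m)%type.

Definition sigma_env (S : params) (x : 'I_m * 'I_m) : R := phiG S.1 S.2 x.1 x.2.

Lemma polyfun_lambda i j : polyfun (@theta_env R m) (fun S => S.1 i j).
Proof. exact: (polyfun_var (@theta_env R m) (inl (i, j))). Qed.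

Lemma polyfun_omega i j : polyfun (@theta_env R m) (fun S => S.2 i j).
Proof. exact: (polyfun_var (@theta_env R m) (inr (i, j))). Qed.

Lemma fsub_1subL (C : (params -> R) -> Prop) i j : function_subalgebra C ->
  C (fun S => S.1 i j) -> C (fun S => (1%:M - S.1) i j).
Proof.
move=> algC CL; have := fsub_sub algC (fsub_const algC (i == j)%:R) CL.
by apply: fsub_ext => // S; rewrite !mxE.
Qed.

Lemma polyfun_det_1subL : polyfun (@theta_env R m) (fun S => \det (1%:M - S.1)).
Proof.
have alg := polyfun_subalgebra (@theta_env R m).
apply: (fsub_det alg) => i j; apply: fsub_1subL => //; exact: polyfun_lambda.
Qed.

Lemma polyfun_det_adj_half_matrix n h (y p : 'I_n -> 'I_m) :
  polyfun (@theta_env R m) (fun S => \det (adj_half_matrix h y p S.1 S.2)).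
Proof.
have alg := polyfun_subalgebra (@theta_env R m).
have padj a b : polyfun (@theta_env R m) (fun S => (\adj (1%:M - S.1)) a b).
  apply: fsub_adj => // c d; apply: fsub_1subL => //; exact: polyfun_lambda.
apply: fsub_det => // i j; case hi: (h i).
  apply: (@fsub_ext _ _ _ alg (fun S => (S.2 *m \adj (1%:M - S.1)) (y i) (p j))).
    by move=> S; rewrite [RHS]mxE hi.
  by apply: fsub_mulmx => // k; apply: polyfun_omega.
apply: (@fsub_ext _ _ _ alg (fun S =>
  ((\adj (1%:M - S.1))^T *m S.2 *m \adj (1%:M - S.1)) (y i) (p j))).
  by move=> S; rewrite [RHS]mxE hi.
apply: fsub_mulmx => // k; apply: fsub_mulmx => // l; last exact: polyfun_omega.
by apply: (fsub_ext alg _ (padj l (y i))) => S; rewrite [RHS]mxE.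
Qed.

(** A boolean test; unlike [in_htr] it does not exclude [v] and its siblings. *)
Definition half_reachable v w := [exists u, ((u == v) || B u v) && connect D u w].

Lemma half_reachable_htr v w : symmetric B -> w \notin v |: sib B v ->
  half_reachable v w -> in_htr D B v w.
Proof.
move=> symB wv /existsP[u /andP[uv /connectP[q pq wE]]]; split=> //; rewrite wE.
have [euv|neq] := eqVneq u v.
  by exists (Trek false v [::] v q); rewrite /is_halftrek /is_trek /= -euv pq eqxx.
exists (Trek true v [::] u q); rewrite /is_halftrek /is_trek /= pq symB.
by move: uv; rewrite (negbTE neq) /= => ->.
Qed.

Lemma phiGM (L O : 'M[R]_m) : 1%:M - L \in unitmx ->
  phiG L O *m (1%:M - L) = (invmx (1%:M - L))^T *m O.
Proof. by move=> uM; rewrite /phiG mulmxKV. Qed.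

Lemma MphiG (L O : 'M[R]_m) : 1%:M - L \in unitmx ->
  (1%:M - L)^T *m phiG L O = O *m invmx (1%:M - L).
Proof.
by move=> uM; rewrite /phiG !mulmxA -trmx_mul mulVmx // trmx1 mul1mx.
Qed.

(** [f] is chosen before [P], so that a single domain can later be cut out by the determinants of
    all nodes together. *)
Lemma column_identified v Y : symmetric B -> HTC D B v Y ->
  exists f : params -> R,
  [/\ polyfun (@theta_env R m) f,
      exists S, param_space D B S.1 S.2 /\ f S != 0 &
      forall P : params -> Prop,
        (forall S, P S -> in_Theta D B S.1 S.2 /\ f S != 0) ->
        (forall w u, w \in Y -> in_htr D B v w ->
          ratfun sigma_env P (fun S => S.1 u w)) ->
        forall w, ratfun sigma_env P (fun S => S.1 w v)].
Proof.
move=> symB HTCv; have [n [y [p [injp paE yY exS]]]] := HTC_half_matrix R symB HTCv.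
have yv i : y i \notin v |: sib B v.
  case: HTCv => _ /setP/(_ (y i)) + _; by rewrite !inE yY => /= ->.
pose h i := half_reachable v (y i).
exists (fun S => \det (adj_half_matrix h y p S.1 S.2)); split.
- exact: polyfun_det_adj_half_matrix.
- have [L [O [spS uM nz]]] := exS h.
  by exists (L, O); rewrite det_adj_half_matrix.
move=> P PTheta ratY w.
have alg := ratfun_subalgebra sigma_env P.
(* Row [y i] of M^T Sigma involves only column [y i] of L, which is already known when [y i] is
   half-trek reachable. *)
pose X i (S : params) := if h i then (1%:M - S.1)^T *m phiG S.1 S.2 else phiG S.1 S.2.
pose A S : 'M[R]_n := \matrix_(i, j) X i S (y i) (p j).
pose b S : 'cV[R]_n := \col_i X i S (y i) v.
have ratX i j : ratfun sigma_env P (fun S => X i S (y i) j).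
  have ratS a c : ratfun sigma_env P (fun S => phiG S.1 S.2 a c).
    by apply/polyfun_rat; apply: (polyfun_var sigma_env (a, c)).
  rewrite /X; case hi: (h i) => //.
  apply: fsub_mulmx => // k.
  apply: (@fsub_ext _ _ _ alg (fun S => (1%:M - S.1) k (y i))).
    by move=> S; rewrite [RHS]mxE.
  by apply: fsub_1subL => //; apply: ratY => //; apply: half_reachable_htr.
have ratA i j : ratfun sigma_env P (fun S => A S i j).
  by apply: (fsub_ext alg _ (ratX i (p j))) => S; rewrite mxE.
have ratb i : ratfun sigma_env P (fun S => b S i 0).
  by apply: (fsub_ext alg _ (ratX i v)) => S; rewrite mxE.
have detA S : P S -> \det (A S) != 0.
  case/PTheta => -[[_ uM] _]; rewrite det_adj_half_matrix //.
  congr (\det _ != 0); apply/matrixP=> i j; rewrite !mxE /X.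
  by case: ifP => // _; rewrite MphiG.
have system S : P S -> A S *m (\col_j S.1 (p j) v) = b S.
  case/PTheta => -[[suppL uM] [_ suppO _]] _.
  apply/colP=> i; rewrite !mxE.
  have yvP : y i != v /\ ~~ B (y i) v.
    by have := yv i; rewrite !inE negb_or => /andP[].
  (* If [h i], this is the entry of O at (y i, v), zero as [y i] is neither [v] nor a sibling.
     Otherwise it is an entry of (M^-1)^T O, where a nonzero term would need [y i] reachable from
     [v] or one of its siblings. *)
  have : (X i S *m (1%:M - S.1)) (y i) v = 0.
    rewrite /X; case: ifP => [_|/negbT nh].
      by rewrite -mulmxA phiGM // mulmxA -trmx_mul mulVmx // trmx1 mul1mx suppO; case: yvP.
    rewrite phiGM // mxE big1 // => u _; rewrite mxE.
    have [uv|nuv] := boolP ((u == v) || B u v).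
      rewrite (invmx_connect suppL) ?mul0r //; apply: contra nh => con.
      by apply/existsP; exists u; rewrite uv.
    by rewrite negb_or in nuv; case/andP: nuv => ? ?; rewrite suppO ?mulr0.
  rewrite mulmxBr mulmx1 mxE [X in _ + X]mxE => /eqP; rewrite subr_eq0 => /eqP ->.
  rewrite mxE [RHS](bigID (mem (pa D v))) /= [X in _ + X]big1 ?addr0 => [|u]; last first.
    by rewrite inE => nD; rewrite suppL ?mulr0.
  rewrite paE big_imset /= => [|? ? _ _]; last exact: injp.
  by apply: eq_bigr => j _; rewrite !mxE.
have [|nw] := boolP (w \in pa D v); last first.
  apply: (@ratfun_ext _ _ _ sigma_env P (fun=> 0)); last exact: fsub_const.
  by move=> S /PTheta[[[suppL _] _] _]; rewrite suppL //; rewrite inE in nw.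
rewrite paE => /imsetP[j _ ->].
apply: (@ratfun_ext _ _ _ sigma_env P
  (fun S => (\det (A S))^-1 * (\adj (A S) *m b S) j 0)).
  move=> S PS; have d0 := detA S PS; have uA : A S \in unitmx by rewrite unitmxE unitfE.
  have := congr1 (fun x => (invmx (A S) *m x) j 0) (system S PS).
  by rewrite mulKmx // {1}/invmx uA -scalemxAl !mxE => ->.
apply: fsub_mul => //.
  by apply: ratfun_inv => //; apply: fsub_det.
by apply: fsub_mulmx => // k; apply: fsub_adj.
Qed.

End Columns.

(** * Recursion along the ordering and the exceptional set *)

Theorem mainTheorem1 (R : realFieldType) (m : nat) (D B : rel 'I_m)
  (HDirr : irreflexive D) (HBirr : irreflexive B) (HBsym : symmetric B)
  (Y : 'I_m -> {set 'I_m})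
  (HY : forall v, HTC D B v (Y v))
  (prec : rel 'I_m)
  (Hprec_irr : irreflexive prec) (Hprec_tr : transitive prec)
  (Hprec_tot : forall v w, v != w -> prec v w || prec w v)
  (Hord : forall v w, w \in Y v -> in_htr D B v w -> prec w v) :
  rationally_identifiable R D B.
Proof.
have /fin_all_exists[f fP] v := column_identified R HBsym (HY v).
have pf v : polyfun (@theta_env R m) (f v) by case: (fP v).
have [q qE] : polyfun (@theta_env R m) (fun S => \prod_v f v S).
  by apply: fsub_prod => //; apply: polyfun_subalgebra.
pose P (S : 'M[R]_m * 'M[R]_m) := in_Theta D B S.1 S.2 /\ peval (theta_env S) q != 0.
have alg := ratfun_subalgebra (@sigma_env R m) P.
have ratL v : forall w, ratfun (@sigma_env R m) P (fun S => S.1 w v).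
  (* Strong induction on the number of predecessors of [v]. *)
  have [k] := ubnP #|[pred u | prec u v]|; elim: k v => // k IHk v ltk.
  have [_ _ colv] := fP v; apply: colv => [S [Th]|w u wY wv].
    by rewrite -qE (bigD1 v) //= mulf_eq0 negb_or => /andP[].
  have wltv := Hord v w wY wv.
  apply: IHk; apply: leq_trans (proper_card _) (ltk : _ <= k)%N.
  apply/properP; split; last by exists w; rewrite inE ?Hprec_irr.
  by apply/subsetP => a; rewrite !inE => /Hprec_tr; apply.
have ratO v w : ratfun (@sigma_env R m) P (fun S => S.2 v w).
  apply: (@ratfun_ext _ _ _ _ _ (fun S =>
    ((1%:M - S.1)^T *m phiG S.1 S.2 *m (1%:M - S.1)) v w)).
    by move=> S [[[_ uM] _] _]; rewrite MphiG // mulmxKV.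
  have ratM a b : ratfun (@sigma_env R m) P (fun S => (1%:M - S.1) a b).
    exact: fsub_1subL.
  apply: fsub_mulmx => // a; apply: fsub_mulmx => // b.
    by apply: (fsub_ext alg _ (ratM b v)) => S; rewrite [RHS]mxE.
  by apply: polyfun_rat; apply: (polyfun_var (@sigma_env R m) (b, a)).
have /fin_all_exists[psi psiP] (k : Defs.coord m) : exists ab, forall S, P S ->
    let ev := peval (sigma_env S) in
    ev ab.2 != 0 /\ ev ab.1 / ev ab.2 = theta_coord S.1 S.2 k.
  have [a [b ab]] : ratfun (@sigma_env R m) P (fun S => theta_coord S.1 S.2 k).
    by case: k => -[v w]; [apply: ratL|apply: ratO].
  by exists (a, b) => S /ab[nz ->].
exists (fun e => e = q), psi; split; last first.
  move=> L O Th nW k; apply: (psiP k (L, O)); split=> //.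
  by apply/eqP => q0; apply: nW; split=> // _ ->.
have [|S [spS nzS]] := common_nonzero (D := D) (B := B) (enum 'I_m) pf.
  by move=> v; case: (fP v).
have [d [d0 PDd]] := line_PD spS.
have nz0 : \det (1%:M - (base_point R m).1) != 0.
  by rewrite /= subr0 det1 oner_neq0.
have nzq : peval (theta_env S) q != 0 by rewrite -qE -big_enum.
(* det(1 - L) is nonzero at the start of the line and [q] at its end; a common nonzero with t < d
   also has O positive definite, hence lies in Theta. *)
have [t [t0 td nzdet nzt]] := line_nonzero (@polyfun_det_1subL R m)
  (ex_intro _ q (fun=> erefl)) nz0 nzq d0.
have [suppL _ _] := param_space_line t (param_space_base R D B) spS.
exists (line (base_point R m) S t).1, (line (base_point R m) S t).2; split.
  by split; [split=> //; rewrite unitmxE unitfE|apply: PDd].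
by case=> _ /(_ q erefl) /eqP; apply/negP.
Qed.
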